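(* Let $A$ and $B$ be lattices with zero. Then the following statements are equivalent: (i) $A\otimes B$ is a capped tensor product. (ii) For every semilattice homomorphism $\varphi\colon (A^-;\vee)\to(\mathrm{Id}\,B;\cap)$ and every step function $\xi\colon A^-\to B$ which is a choice function for $\varphi$, there exists a step function $\eta\colon A^-\to B$ such that $\xi(a)\le\eta(a)\in\varphi(a)$ for all $a\in A^-$, and $\eta$ is a semilattice homomorphism from $(A^-;\vee)$ to $(B;\wedge)$. (iii) The adjustment sequence of any step function $\xi\colon A^-\to B$ is eventually constant.
   Context: Tensor product. For lattices $A$, $B$ with least elements $0$, put $\bot_{A,B}=(A\times\{0\})\cup(\{0\}\times B)$. A bi-ideal of $A\times B$ is a subset $I\subseteq A\times B$ which is a down-set (for the componentwise order), contains $\bot_{A,B}$, and is closed under lateral joins: $(a,b_0),(a,b_1)\in I$ implies $(a,b_0\vee b_1)\in I$, and $(a_0,b),(a_1,b)\in I$ implies $(a_0\vee a_1,b)\in I$. Ordered by inclusion, the bi-ideals form an algebraic lattice $A\,\bar\otimes\, B$. For $a\in A$, $b\in B$ the pure tensor is the bi-ideal $a\otimes b=\bot_{A,B}\cup\{(x,y)\in A\times B : x\le a,\ y\le b\}$. The tensor product $A\otimes B$ is the join-semilattice with zero of compact elements of $A\,\bar\otimes\,B$, i.e. the set of all finite joins (in $A\,\bar\otimes\,B$) of pure tensors, ordered by inclusion. $A\otimes B$ is a capped tensor product if every element of $A\otimes B$ is a finite union (as sets) of pure tensors. $A^-=A\setminus\{0\}$, $B^-=B\setminus\{0\}$; $\mathrm{Id}\,B$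 is the set of all (nonempty) ideals of $B$, a semilattice under intersection. A map $\xi\colon A^-\to B$ is a choice function for $\varphi\colon A^-\to\mathrm{Id}\,B$ if $\xi(x)\in\varphi(x)$ for all $x\in A^-$. Step functions. For $a\in A$ put $(a]_\bullet=\{x\in A^- : x\le a\}$. $\mathrm{Int}\,A$ is the Boolean subalgebra of the power set of $A^-$ generated by all sets $(a]_\bullet$, $a\in A^-$; $\mathrm{Int}_*A$ is the ideal of $\mathrm{Int}\,A$ consisting of all $X\in\mathrm{Int}\,A$ with $X\subseteq(a]_\bullet$ for some $a\in A$. A map $\xi\colon A^-\to B$ is a step function if its range is finite and $\xi^{-1}\{b\}\in\mathrm{Int}_*A$ for all $b\in B^-$. Adjustment sequence. For $x\in A^-$, let $\mathcal{C}(x)$ be the set of all nonempty finite subsets $S\subseteq A^-$ with $x\le\bigvee S$. For a map $\xi\colon A^-\to B$ with finite range, the one-step adjustment $\xi^{(1)}\colon A^-\to B$ is $\xi^{(1)}(x)=\bigvee\{\bigwedge\xi[S] : S\in\mathcal{C}(x)\}$ (a finite join since the range of $\xi$ is finite; $\xi^{(1)}$ again has finite range, and is a step function if $\xi$ is). The adjustment sequence of a step function $\xi$ is the sequence $(\xi^{(n)})_{n\in\omega}$ with $\xi^{(0)}=\xi$ and $\xi^{(n+1)}=(\xi^{(n)})^{(1)}$. *)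

(* Defs.v *)
From HB Require Import structures.
From mathcomp Require Import all_boot all_order.
From mathcomp Require Import finmap boolp classical_sets functions cardinality.
Set Implicit Arguments.
Unset Strict Implicit.
Unset Printing Implicit Defensive.
Import Order.TTheory.
Local Open Scope order_scope.
Local Open Scope classical_set_scope.

Definition nonzero (d : Order.disp_t) (A : bLatticeType d) : Type :=
  {a : A | a != \bot}.

Section NonzeroSemilattice.
Context (d : Order.disp_t) (A : bLatticeType d).

HB.instance Definition _ := SubChoice.copy (nonzero A) {a : A | a != \bot}.
HB.instance Definition _ := [SubChoice_isSubPOrder of nonzero A by <: with d].

Fact nz_join_subproof (x y : nonzero A) : (val x `|` val y)%O != \bot.
Proof. by rewrite join_eq0 negb_and (valP x). Qed.

Definition nz_join (x y : nonzero A) : nonzero A :=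
  exist _ (val x `|` val y)%O (nz_join_subproof x y).

Fact nz_leUx (x y z : nonzero A) :
  (nz_join x y <= z) = (x <= z) && (y <= z).
Proof. exact: leUx. Qed.

HB.instance Definition _ :=
  @Order.POrder_isJoinSemilattice.Build d (nonzero A) nz_join nz_leUx.

End NonzeroSemilattice.

Definition ideal (d : Order.disp_t) (B : bLatticeType d) : set (set B) :=
  [set I | [/\ I !=set0,
               (forall x y : B, x <= y -> I y -> I x) &
               (forall x y : B, I x -> I y -> I (x `|` y)%O)]].

Section TensorProduct.
Context (dA dB : Order.disp_t) (A : bLatticeType dA) (B : bLatticeType dB).

Definition tensor_bot : set (A * B) :=
  [set p | p.1 = \bot \/ p.2 = \bot].

Definition bi_ideal : set (set (A * B)) :=
  [set I | [/\ tensor_bot `<=` I,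
               (forall x a y b, x <= a -> y <= b -> I (a, b) -> I (x, y)),
               (forall a b0 b1, I (a, b0) -> I (a, b1) -> I (a, b0 `|` b1)%O) &
               (forall a0 a1 b, I (a0, b) -> I (a1, b) -> I (a0 `|` a1, b)%O)]].

(* The join of a family of bi-ideals in the complete lattice of bi-ideals;
   for the empty family this is tensor_bot. *)
Definition bi_ideal_join (F : set (set (A * B))) : set (A * B) :=
  smallest bi_ideal (\bigcup_(I in F) I).

Definition pure_tensor (p : A * B) : set (A * B) :=
  tensor_bot `|` [set q | q.1 <= p.1 /\ q.2 <= p.2].

Definition tensor_product : set (set (A * B)) :=
  [set H | exists s : {fset A * B},
             H = bi_ideal_join (pure_tensor @` [set` s])].

Definition capped_tensor_product : Prop :=
  forall H, tensor_product H ->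
    exists s : {fset A * B}, H = \bigcup_(p in [set` s]) pure_tensor p.

End TensorProduct.

Section StepFunctions.
Context (dA dB : Order.disp_t) (A : bLatticeType dA) (B : bLatticeType dB).

Definition nz_downset (a : A) : set (nonzero A) := [set x | val x <= a].

Definition boolean_subalgebra (T : Type) : set (set (set T)) :=
  [set F | [/\ F setT, setI_closed F & forall X, F X -> F (~` X)]].

Definition Int : set (set (nonzero A)) :=
  smallest (@boolean_subalgebra (nonzero A))
    [set nz_downset (val a) | a in [set: nonzero A]].

Definition Int_star : set (set (nonzero A)) :=
  [set X | Int X /\ exists a : A, X `<=` nz_downset a].

Definition step_function (xi : nonzero A -> B) : Prop :=
  finite_set (range xi) /\
  forall b : B, b != \bot -> Int_star (xi @^-1` [set b]).

Definition choice_function (phi : nonzero A -> set B) (xi : nonzero A -> B) :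
  Prop := forall x, phi x (xi x).

Definition covers (x : nonzero A) : set {fset nonzero A} :=
  [set S | (S != fset0)%fset /\ val x <= \join_(y <- S) val y].

(* The infimum is over a nonempty finite set, and, when the range of xi is
   finite, so is the supremum: both then exist in B and the default value
   \bot is not used. *)
Definition adjustment (xi : nonzero A -> B) (x : nonzero A) : B :=
  supremum \bot [set infimum \bot (xi @` [set` S]) | S in covers x].

Definition adjustment_seq (xi : nonzero A -> B) (n : nat) : nonzero A -> B :=
  iter n adjustment xi.

Definition eventually_constant (T : Type) (u : nat -> T) : Prop :=
  exists N : nat, forall n : nat, (N <= n)%N -> u n = u N.

End StepFunctions.

(* Main.v *)
Require Import Defs.
From mathcomp Require Import all_boot all_order.
From mathcomp Require Import finmap boolp classical_sets functions cardinality.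
Local Open Scope order_scope.
Local Open Scope classical_set_scope.
Set Implicit Arguments.
Unset Strict Implicit.
Unset Printing Implicit Defensive.
Import Order.TTheory.

(** Bi-ideals [H] of [A * B] correspond to homomorphisms [phi] from [A^-] to
    ideals of [B], through the sections [phi a = {b | (a, b) in H}], and finite
    unions of pure tensors that are bi-ideals correspond to step functions that
    are homomorphisms.  Everything rests on a finiteness property of a step
    function [xi]: there is a finite set [M] of elements of [A^-] such that
    every [x] with [xi x <> 0] lies below some [m] in [M] with [xi m = xi x]
    (take the meets of the finitely many elements of [A] needed to describe the
    fibres of [xi]).
    (i) => (ii): the bi-ideal generated by the pairs [(m, xi m)], [m] in [M], is
    capped, and its section is the required [eta].
    (ii) => (iii): the ideals [{b | b <= xi^(n) x for some n}] form a
    homomorphism [phi]; the [eta] obtained for it dominates all [xi^(n)], and it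
    is reached at a finite stage because only finitely many values [eta m]
    matter.
    (iii) => (i): for a finite join [H] of pure tensors [(a_i, b_i)], adjust
    [xi x = \/ {b_i | x <= a_i}]; all adjustments stay inside [H], and the limit
    is a homomorphism, so its graph is all of [H]. *)

(** * Suprema and infima of finite families *)

Section FiniteBounds.
Context (T : choiceType) (d : Order.disp_t) (L : latticeType d).

Lemma supremum_eq (x0 l : L) (E : set L) :
  E !=set0 -> supremums E l -> supremum x0 E = l.
Proof.
move=> /set0P/negbTE E0 El; rewrite /supremum E0.
exact: (@is_subset1_supremums _ _ E _ _ (xgetPex x0 (ex_intro _ l El)) El).
Qed.

Lemma infimum_eq (x0 l : L) (E : set L) :
  E !=set0 -> infimums E l -> infimum x0 E = l.
Proof.
move=> /set0P/negbTE E0 El; rewrite /infimum E0.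
exact: (@is_subset1_infimums _ _ E _ _ (xgetPex x0 (ex_intro _ l El)) El).
Qed.

Lemma le_infimum_image (x0 c : L) (f : T -> L) (S : {fset T}) :
  S != fset0 ->
  c <= infimum x0 (f @` [set` S]) <-> forall y, y \in S -> c <= f y.
Proof.
case/fset0Pn=> z zS.
(* The fold starts at the value [f z] of a member of [S], since [L] need not have a top element. *)
pose l := foldr (fun y m => f y `&` m)%O (f z) (enum_fset S).
have lP b : b <= l <-> forall y, y \in S -> b <= f y.
  have: b <= l <-> (forall y, y \in z :: enum_fset S -> b <= f y).
    rewrite /l; elim: (enum_fset S) => [|y s IHs] /=.
      by split=> [bz y|]; [rewrite inE => /eqP-> | apply; rewrite mem_head].
    rewrite lexI; split=> [/andP[by_ /IHs bs] w|bs].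
      rewrite !inE orbCA => /orP[/eqP->//|ws]; apply: bs.
      by rewrite inE.
    rewrite bs ?inE ?eqxx ?orbT //=; apply/IHs => w.
    by rewrite inE => /orP[] ws; apply: bs; rewrite !inE ws ?orbT.
  move=> ->; split=> bS y; first by move=> yS; apply: bS; rewrite inE yS orbT.
  by rewrite inE => /predU1P[->|yS]; apply: bS.
rewrite (@infimum_eq x0 l) //; first by exists (f z), z.
split=> [_ [y yS <-]|b bS]; first exact: (proj1 (lP l) (lexx l)).
by apply/lP => y yS; apply: bS; exists y.
Qed.

End FiniteBounds.

(** * Finite domination of step functions *)

Section StepFunctions.
Context (dA dB : Order.disp_t) (A : bLatticeType dA) (B : bLatticeType dB).
Implicit Types (xi eta : nonzero A -> B) (x y m : nonzero A) (s : seq (A * B)).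

(** The sets whose membership depends only on comparisons with finitely many elements form a Boolean
    subalgebra containing the generators. *)
Lemma Int_determined (X : set (nonzero A)) : Int X ->
  exists G : seq A, forall x y,
    {in G, forall g, (val x <= g) = (val y <= g)} -> X x -> X y.
Proof.
apply: (@smallest_sub _ _ _ [set X : set (nonzero A) | exists G : seq A,
  forall x y, {in G, forall g, (val x <= g) = (val y <= g)} -> X x -> X y]).
  split; first by exists [::].
    move=> X1 X2 [G1 P1] [G2 P2]; exists (G1 ++ G2) => x y xy [X1x X2x].
    split; [apply: P1 X1x | apply: P2 X2x] => g gG; apply: xy;
      by rewrite mem_cat gG ?orbT.
  move=> X1 [G P]; exists G => x y xy nXx /(P y x) Xx; apply: nXx.
  by apply: Xx => g /xy.
move=> _ [a _ <-]; exists [:: val a] => x y xy.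
by rewrite /nz_downset /= -xy ?mem_head.
Qed.

(** Induction on [G], starting from [M = {a}]: each new [g] adds all meets with [g]. If [x <= g],
    the old [m] is replaced by its meet with [g]; otherwise [m] is kept, and [m <= g] fails because
    [x <= m]. *)
Lemma finite_meets (G : seq A) (a : A) : exists M : seq A, forall x : A,
  x <= a -> exists2 m, m \in M &
    x <= m /\ {in G, forall g, (m <= g) = (x <= g)}.
Proof.
elim: G => [|g G [M MP]].
  by exists [:: a] => x xa; exists a; rewrite ?mem_head.
exists (M ++ [seq (g `&` m)%O | m : A <- M]) => x /MP[m mM [xm mG]].
have [xg|xNg] := boolP (x <= g).
  exists (g `&` m)%O; first by rewrite mem_cat map_f ?orbT.
  split; first by rewrite lexI xg.
  move=> h; rewrite inE => /predU1P[->|hG]; first by rewrite leIl xg.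
  apply/idP/idP => [|xh]; first by apply: le_trans; rewrite lexI xg.
  by rewrite (le_trans (leIr _ _)) // mG.
exists m; first by rewrite mem_cat mM.
split=> // h; rewrite inE => /predU1P[->|/mG//].
by rewrite (negbTE xNg); apply: contraNF xNg; apply: le_trans.
Qed.

Lemma nonzero_le x (a : A) : val x <= a -> a != \bot.
Proof.
by apply: contraTneq => ->; rewrite lex0; exact: valP x.
Qed.

Lemma Int_star_dominated (X : set (nonzero A)) : Int_star X ->
  exists M : seq (nonzero A), forall x, X x ->
    exists2 m, m \in M & x <= m /\ X m.
Proof.
move=> [/Int_determined[G GP] [a Xa]]; have [M MP] := finite_meets G a.
exists (pmap insub M) => x Xx; have [m mM [xm mG]] := MP _ (Xa _ Xx).
have m0 : m != \bot.
  exact: nonzero_le xm.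
exists (Sub m m0); first by rewrite mem_pmap_sub.
by split=> //; apply: GP Xx => g /mG; rewrite SubK => ->.
Qed.

Definition dominated_by (M : {fset nonzero A}) xi :=
  forall x, xi x != \bot -> exists2 m, m \in M & x <= m /\ xi m = xi x.

Lemma step_function_dominated xi :
  step_function xi -> exists M, dominated_by M xi.
Proof.
move=> [/finite_fsetP[R RE] xi_step].
have /choice[F FP] (b : B) : exists M : seq (nonzero A), b != \bot ->
    forall x, xi x = b -> exists2 m, m \in M & x <= m /\ xi m = b.
  have [->|b0] := eqVneq b \bot; first by exists [::].
  by have [M MP] := Int_star_dominated (xi_step b b0); exists M.
exists [fset m in flatten [seq F b | b <- R]]%fset => x xi0.
have [m mF mx] := FP _ xi0 x erefl; exists m => //.
rewrite !inE; apply/flattenP; exists (F (xi x)) => //; apply/map_f.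
by have : [set` R] (xi x) by rewrite -RE; exists x.
Qed.

(** * Step functions given by finitely many pairs *)

(** When the pure tensors of [s] have a bi-ideal as union, this is the largest [b] with [(val x, b)]
    in it. *)
Definition tensor_section s x : B := \join_(p <- s | val x <= p.1) p.2.

Lemma tensor_section_le s x c :
  tensor_section s x <= c <-> forall p, p \in s -> val x <= p.1 -> p.2 <= c.
Proof. by split => /joinsP_seq. Qed.

Lemma boolean_Int : boolean_subalgebra (@Int _ A).
Proof.
split=> [F [] []//|X Y IX IY F FG|X IX F FG]; have [[_ FI FC] _] := FG.
  by apply: FI; [apply: IX | apply: IY].
by apply: FC; apply: IX.
Qed.

Lemma nz_downset_Int (a : A) : Int (nz_downset a).
Proof.
have [IT _ IC] := boolean_Int.
have [->|a0] := eqVneq a \bot.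
  rewrite (_ : nz_downset _ = ~` setT); first exact: IC.
  rewrite setCT; apply/seteqP; split=> // x; rewrite /nz_downset /= lex0.
  by rewrite (negbTE (valP x)).
by apply: sub_gen_smallest; exists (Sub a a0).
Qed.

Lemma step_tensor_section s : step_function (tensor_section s).
Proof.
have sec_cons p r x : tensor_section (p :: r) x =
    if val x <= p.1 then (p.2 `|` tensor_section r x)%O else tensor_section r x.
  by rewrite /tensor_section big_cons.
have sec_nil x : tensor_section [::] x = \bot by rewrite /tensor_section big_nil.
have [IT II IC] := boolean_Int.
(* The set [C] is arbitrary because the induction replaces it, on the part below [p.1], by its
   preimage under joining with [p.2]. *)
have sec_Int (C : set B) : Int (tensor_section s @^-1` C).
  elim: s C => [|p r IHr] C.
    have [C0|C0] := pselect (C \bot).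
      rewrite (_ : _ @^-1` _ = setT) //; apply/seteqP; split=> // x _.
      by rewrite /= sec_nil.
    rewrite (_ : _ @^-1` _ = ~` setT); first exact: IC.
    by rewrite setCT; apply/seteqP; split=> // x; rewrite /= sec_nil.
  rewrite (_ : _ @^-1` _ =
    ~` (~` (nz_downset p.1 `&` tensor_section r @^-1` [set c | C (p.2 `|` c)%O])
        `&` ~` (~` nz_downset p.1 `&` tensor_section r @^-1` C))).
    apply: (IC); apply: (II); apply: (IC); apply: (II); rewrite ?IHr //.
      exact: nz_downset_Int.
    by apply: (IC); apply: nz_downset_Int.
  rewrite setCI !setCK; apply/seteqP; split=> x; rewrite /nz_downset /= sec_cons.
    by case: ifP => xp Cx; [left | right].
  by case=> -[]; [move=> -> | move=> /negP/negbTE->].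
split=> [|b b0].
  elim: s {sec_Int} => [|p r IHr].
    by apply: (sub_finite_set _ (finite_set1 \bot)) => _ [x _ <-]; exact: sec_nil.
  pose j c := (p.2 `|` c)%O.
  apply: (@sub_finite_set _ _ (range (tensor_section r) `|`
      j @` range (tensor_section r))).
    move=> _ [x _ <-]; rewrite sec_cons; case: ifP => _.
      by right; exists (tensor_section r x) => //; exists x.
    by left; exists x.
  by rewrite finite_setU; split=> //; exact: finite_image.
(* An [x] not below this join lies below no [p.1], so its value is an empty join. *)
split=> //; exists (\join_(p <- s) p.1) => x xb; rewrite /nz_downset /=.
apply: contraNT b0 => xNs; rewrite -lex0 -xb; apply/tensor_section_le => p ps xp.
by case/negP: xNs; apply: le_trans xp _; apply: joins_sup_seq.
Qed.

(** * The one-step adjustment *)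

Definition cover_inf xi (S : {fset nonzero A}) : B :=
  infimum \bot (xi @` [set` S]).

Lemma cover_inf_le xi (S : {fset nonzero A}) y : y \in S -> cover_inf xi S <= xi y.
Proof.
move=> yS; have S0 : S != fset0 by apply/fset0Pn; exists y.
by move: y yS; apply/(le_infimum_image \bot _ xi S0).
Qed.

Definition cover_pairs xi (M : {fset nonzero A}) : seq (A * B) :=
  [seq (\join_(y <- C) val y, cover_inf xi C)
  | C : {fset nonzero A} <- [seq C <- fpowerset M | C != fset0]].

Lemma covers1 x : covers x [fset x]%fset.
Proof.
split; first by apply/fset0Pn; exists x; rewrite inE.
by apply: joins_sup_seq; rewrite ?inE.
Qed.

(** Covers inside [M] suffice. A cover containing a zero of [xi] contributes only 0; in any other
    cover each element can be replaced by elements of [M] above it with the same value, which still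
    cover [x] and do not lower the infimum. *)
Lemma adjustment_supremums xi M x : dominated_by M xi ->
  supremums [set cover_inf xi C | C in covers x]
    (tensor_section (cover_pairs xi M) x).
Proof.
move=> xiM; split=> [_ [S [S0 xS] <-]|c cS].
  have [[y yS xiy]|xi0] := pselect (exists2 y, y \in S & xi y = \bot).
    suff -> : cover_inf xi S = \bot by rewrite le0x.
    by apply/eqP; rewrite -lex0 -xiy; exact: cover_inf_le.
  have xiS y : y \in S -> exists2 m, m \in M & y <= m /\ xi m = xi y.
    by move=> yS; apply: xiM; apply/eqP => xiy; apply: xi0; exists y.
  pose S' := [fset m in M | `[< exists2 y, y \in S & y <= m /\ xi m = xi y >]]%fset.
  have S'P y : y \in S -> exists2 m, m \in S' & y <= m.
    move=> yS; have [m mM my] := xiS _ yS; exists m; last by case: my.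
    by rewrite !inE mM; apply/asboolP; exists y.
  have S'0 : S' != fset0.
    case/fset0Pn: S0 => y /S'P[m mS' _]; apply/fset0Pn; by exists m.
  apply: (@le_trans _ _ (cover_inf xi S')).
    apply/le_infimum_image => // m; rewrite !inE => /andP[_ /asboolP[y yS [_ ->]]].
    exact: cover_inf_le.
  apply: (@joins_sup_seq _ _ _ _ _ snd (\join_(y <- S') val y, cover_inf xi S')).
    apply/mapP; exists S' => //.
    rewrite mem_filter S'0 fpowersetE; apply/fsubsetP => m.
    by rewrite !inE => /andP[].
  apply: le_trans xS _; apply/joinsP_seq => y yS _.
  have [m mS' ym] := S'P _ yS; exact: joins_min_seq mS' _ ym.
apply/tensor_section_le => _ /mapP[S + ->] xS /=; rewrite mem_filter.
by case/andP=> S0 _; apply: cS; exists S.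
Qed.

Lemma adjustment_section xi M : dominated_by M xi ->
  adjustment xi = tensor_section (cover_pairs xi M).
Proof.
move=> xiM; apply/funext => x; apply: supremum_eq.
  by exists (cover_inf xi [fset x]%fset), [fset x]%fset => //; apply: covers1.
exact: adjustment_supremums.
Qed.

Lemma step_adjustment xi : step_function xi -> step_function (adjustment xi).
Proof.
case/step_function_dominated=> M /adjustment_section->.
exact: step_tensor_section.
Qed.

Lemma step_adjustment_seq xi n :
  step_function xi -> step_function (adjustment_seq xi n).
Proof. by move=> xi_step; elim: n => //= n; apply: step_adjustment. Qed.

Section Adjustment.
Context (xi : nonzero A -> B).
Hypothesis xi_step : step_function xi.

Lemma adjustment_le x c :
  adjustment xi x <= c <-> forall S, covers x S -> cover_inf xi S <= c.
Proof.
have [M xiM] := step_function_dominated xi_step.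
have [ub lub] := adjustment_supremums x xiM; rewrite (adjustment_section xiM).
split=> [lec S xS|Sc]; first by apply: le_trans lec; apply: ub; exists S.
by apply: lub => _ [S xS <-]; apply: Sc.
Qed.

Lemma cover_inf_le_adjustment x S : covers x S -> cover_inf xi S <= adjustment xi x.
Proof. by move: S; apply/adjustment_le. Qed.

Lemma le_adjustment x : xi x <= adjustment xi x.
Proof.
apply: le_trans (cover_inf_le_adjustment (covers1 x)).
have [S0 _] := covers1 x.
by apply/le_infimum_image => // y; rewrite inE => /eqP->.
Qed.

Lemma adjustment_anti x y : x <= y -> adjustment xi y <= adjustment xi x.
Proof.
move=> xy; apply/adjustment_le => S [S0 yS]; apply: cover_inf_le_adjustment.
by split=> //; apply: le_trans yS.
Qed.

Lemma meet_le_adjustment x y : (xi x `&` xi y <= adjustment xi (x `|` y))%O.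
Proof.
have S0 : [fset x; y]%fset != fset0.
  by apply/fset0Pn; exists x; rewrite !inE eqxx.
have xyS : covers (x `|` y)%O [fset x; y]%fset.
  by split=> //; rewrite leUx !joins_sup_seq // !inE eqxx ?orbT.
apply: le_trans (cover_inf_le_adjustment xyS).
by apply/le_infimum_image => // z; rewrite !inE => /orP[]/eqP->;
  rewrite ?leIl ?leIr.
Qed.

(** An adjustment is antitone, and at a join it dominates the meet of the original values; at a
    fixed point these are the two required inequalities. *)
Lemma adjustment_fixed_morph : adjustment xi = xi ->
  {morph xi : x y / (x `|` y)%O >-> (x `&` y)%O}.
Proof.
move=> fix_xi x y; apply/eqP; rewrite eq_le lexI.
have /= := meet_le_adjustment x y; rewrite fix_xi => ->.
by rewrite -fix_xi !adjustment_anti ?leUl ?leUr.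
Qed.

End Adjustment.

Lemma adjustment_seq_le xi (m n : nat) : step_function xi -> (m <= n)%N ->
  forall x, adjustment_seq xi m x <= adjustment_seq xi n x.
Proof.
move=> xi_step /subnK <- x; elim: (n - m)%N => //= k IHk.
by apply: le_trans IHk _; apply/le_adjustment/step_adjustment_seq.
Qed.

End StepFunctions.

(** * Bi-ideals and homomorphisms into ideals *)

Section BiIdeals.
Context (dA dB : Order.disp_t) (A : bLatticeType dA) (B : bLatticeType dB).
Implicit Types (xi eta : nonzero A -> B) (H : set (A * B)).

Lemma bi_ideal_joinr H (T : eqType) (a : A) (r : seq T) (P : pred T) (f : T -> B) :
  bi_ideal H -> {in r, forall t, P t -> H (a, f t)} ->
  H (a, \join_(t <- r | P t) f t).
Proof.
case=> H0 _ HB _ Hf; rewrite big_seq_cond.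
elim/big_rec: _ => [|t b /andP[tr Pt] Hb]; first by apply: H0; right.
by apply: HB Hb; apply: Hf.
Qed.

Lemma bi_ideal_joinl H (T : eqType) (b : B) (r : seq T) (P : pred T) (f : T -> A) :
  bi_ideal H -> {in r, forall t, P t -> H (f t, b)} ->
  H (\join_(t <- r | P t) f t, b).
Proof.
case=> H0 _ _ HA Hf; rewrite big_seq_cond.
elim/big_rec: _ => [|t a /andP[tr Pt] Ha]; first by apply: H0; left.
by apply: HA Ha; apply: Hf.
Qed.

(** The condition is vacuous when [p.1] is 0, so all pairs [(0, b)] belong to the graph. *)
Definition hom_graph (phi : nonzero A -> set B) : set (A * B) :=
  [set p | forall x, val x = p.1 -> phi x p.2].

(** One inclusion of the homomorphism law makes [phi] antitone, hence the graph a down-set; the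
    other gives lateral joins in the first coordinate. Lateral joins in the second coordinate come
    from the ideals. *)
Lemma hom_graph_bi_ideal phi : (forall x, ideal (phi x)) ->
  {morph phi : x y / (x `|` y)%O >-> (x `&` y)%classic} ->
  bi_ideal (hom_graph phi).
Proof.
move=> phi_id phiM.
have phi0 x : phi x \bot.
  by have [[b xb] down _] := phi_id x; apply: down xb.
have phi_anti x y : x <= y -> phi y `<=` phi x.
  by move=> /join_idPl <-; rewrite phiM => b [].
split=> [[a b] [/= ->|/= ->]|x a y b xa yb Hab z /= zx|a b0 b1 H0 H1 x /= xa
        |a0 a1 b H0 H1 x /= xa].
- by move=> x x0; have := valP x; rewrite x0 eqxx.
- by move=> x _ /=.
- have za : val z <= a by rewrite [val z]zx.
  have [_ down _] := phi_id z; apply: down yb _.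
  exact: (phi_anti z (Sub a (nonzero_le za)) za) (Hab _ _).
- by have [_ _ joinx] := phi_id x; apply: joinx; [apply: H0|apply: H1].
have [a00|a00] := eqVneq a0 \bot; first by apply: H1; rewrite [val x]xa a00 join0x.
have [a10|a10] := eqVneq a1 \bot; first by apply: H0; rewrite [val x]xa a10 joinx0.
have -> : x = ((Sub a0 a00 : nonzero A) `|` (Sub a1 a10 : nonzero A))%O by apply: val_inj.
by rewrite phiM; split; [apply: H0 | apply: H1].
Qed.

Lemma principal_graph_bi_ideal eta :
  {morph eta : x y / (x `|` y)%O >-> (x `&` y)%O} ->
  bi_ideal (hom_graph (fun x => [set b | b <= eta x])).
Proof.
move=> etaM; apply: hom_graph_bi_ideal => [x|x y].
  split=> [|b c bc|b c /= bx cx]; first by exists \bot; rewrite /= le0x.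
    exact: le_trans.
  by rewrite leUx bx.
by apply/seteqP; split=> b /=; rewrite etaM lexI => /andP.
Qed.

(** Each [(val y, cover_inf eta S)] with [y] in [S] lies in the graph of [eta]; lateral joins and
    the down-set property carry this to [x]. *)
Lemma morph_cover_inf eta x S :
  {morph eta : x y / (x `|` y)%O >-> (x `&` y)%O} ->
  covers x S -> cover_inf eta S <= eta x.
Proof.
move=> /principal_graph_bi_ideal etaH [S0 xS]; have [_ down _ _] := etaH.
apply: (down _ _ _ _ xS (lexx _) (bi_ideal_joinl etaH _) x erefl) => y yS _ z /val_inj->.
exact: cover_inf_le.
Qed.

Lemma adjustment_seq_le_morph xi eta n : step_function xi ->
  {morph eta : x y / (x `|` y)%O >-> (x `&` y)%O} ->
  (forall x, xi x <= eta x) -> forall x, adjustment_seq xi n x <= eta x.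
Proof.
move=> xi_step etaM xi_eta; elim: n => //= n IHn x.
apply/adjustment_le => [|S xS]; first exact: step_adjustment_seq.
apply: le_trans (morph_cover_inf etaM xS); have [S0 _] := xS.
apply/le_infimum_image => // y yS; apply: le_trans (IHn y).
exact: cover_inf_le.
Qed.

Lemma bi_ideal_join_bi_ideal (F : set (set (A * B))) : bi_ideal (bi_ideal_join F).
Proof.
split=> [p p0 I [[I0 _ _ _] _]|x a y b xa yb Iab I II|a b0 b1 I0 I1 I II
        |a0 a1 b I0 I1 I II]; first exact: I0.
- by have [[_ down _ _] _] := II; apply: down xa yb (Iab _ II).
- by have [[_ _ J _] _] := II; apply: J; [apply: I0 | apply: I1].
- by have [[_ _ _ J] _] := II; apply: J; [apply: I0 | apply: I1].
Qed.

Lemma pure_tensor_sub H a b : bi_ideal H -> H (a, b) -> pure_tensor (a, b) `<=` H.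
Proof.
case=> H0 down _ _ Hab [x y] [/H0//|[xa yb]]; exact: down Hab.
Qed.

Lemma pure_tensor_join (s : {fset A * B}) p : p \in s ->
  bi_ideal_join (@pure_tensor _ _ A B @` [set` s]) p.
Proof.
move=> ps; apply: sub_gen_smallest; exists (pure_tensor p); first by exists p.
by right.
Qed.

Lemma bi_ideal_join_sub (s : {fset A * B}) H : bi_ideal H -> [set` s] `<=` H ->
  bi_ideal_join (@pure_tensor _ _ A B @` [set` s]) `<=` H.
Proof.
move=> HH sH; apply: smallest_sub => // q [_ [[a b] /sH Hab <-]].
exact: pure_tensor_sub.
Qed.

Lemma capped_section H (s : {fset A * B}) : bi_ideal H ->
  H = \bigcup_(p in [set` s]) pure_tensor p ->
  H = hom_graph (fun x => [set b | b <= tensor_section s x]).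
Proof.
move=> HH Hs; have [H0 down _ _] := HH; apply/seteqP; split=> -[a b].
  rewrite {1}Hs => -[p ps [[/= ->|/= ->]|[/= ap bp]]] x /= xa.
  - by have := valP x; rewrite [val x]xa eqxx.
  - exact: le0x.
  by apply: joins_min_seq ps _ bp; rewrite [val x]xa.
have [->|a0] := eqVneq a \bot; first by move=> _; apply: H0; left.
(* Every [p] in [s] with [a <= p.1] puts [(a, p.2)] in [H]; lateral joins then reach the value of
   the section. *)
move=> /(_ (Sub a a0) erefl) /= bs; apply: down (lexx a) bs _.
apply: bi_ideal_joinr => // p ps ap; rewrite Hs; exists p => //; by right.
Qed.

Lemma section_in_bi_ideal H (s : {fset A * B}) x : bi_ideal H -> [set` s] `<=` H ->
  H (val x, tensor_section s x).
Proof.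
move=> HH sH; apply: bi_ideal_joinr => // -[a b] ps xa.
by have [_ down _ _] := HH; apply: down xa (lexx _) (sH _ ps).
Qed.

(** For each cover, lateral joins in the first coordinate give its pair in [H]; lateral joins in the
    second coordinate then collect the finitely many covers inside [M]. *)
Lemma adjustment_in_bi_ideal H xi : bi_ideal H -> step_function xi ->
  (forall x, H (val x, xi x)) -> forall x, H (val x, adjustment xi x).
Proof.
move=> HH xi_step Hxi x; have [M xiM] := step_function_dominated xi_step.
have [_ down _ _] := HH.
rewrite (adjustment_section xiM); apply: bi_ideal_joinr => // p /mapP[S _ ->] /= xS.
apply: (down _ _ _ _ xS (lexx _)); apply: bi_ideal_joinl => // y yS _.
exact: (down _ _ _ _ (lexx (val y)) (cover_inf_le xi yS) (Hxi y)).
Qed.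

(** * The three implications *)

Lemma capped_interpolation (phi : nonzero A -> set B) xi :
  capped_tensor_product A B -> (forall x, ideal (phi x)) ->
  {morph phi : x y / (x `|` y)%O >-> (x `&` y)%classic} ->
  step_function xi -> choice_function phi xi ->
  exists eta : nonzero A -> B,
    [/\ step_function eta, (forall a, xi a <= eta a /\ phi a (eta a)) &
        {morph eta : x y / (x `|` y)%O >-> (x `&` y)%O}].
Proof.
move=> capped phi_id phiM xi_step phi_xi.
have [M xiM] := step_function_dominated xi_step.
pose s := [fset (val m, xi m) | m in M]%fset.
pose H := bi_ideal_join (@pure_tensor _ _ A B @` [set` s]).
have HH : bi_ideal H := bi_ideal_join_bi_ideal _.
have [t Ht] : exists t : {fset A * B}, H = \bigcup_(p in [set` t]) pure_tensor p.
  by apply: capped; exists s.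
have Hsec := capped_section HH Ht.
have inH x b : H (val x, b) <-> b <= tensor_section t x.
  by rewrite Hsec; split=> [/(_ x erefl)|bx y /val_inj->].
have [_ down _ HA] := HH.
exists (tensor_section t); split=> [|x|x y]; first exact: step_tensor_section.
  split.
    have [/eqP->|/xiM[m mM [xm <-]]] := boolP (xi x == \bot); first exact: le0x.
    apply/inH; apply: down xm (lexx _) _; apply: pure_tensor_join.
    by apply/imfsetP; exists m.
  (* The generators of [H] lie in the graph of [phi], which is a bi-ideal, so all of [H] does. *)
  suff Hphi : H `<=` hom_graph phi.
    by apply: (Hphi (val x, tensor_section t x)) => //; apply/inH.
  apply: bi_ideal_join_sub; first exact: hom_graph_bi_ideal.
  by move=> _ /imfsetP[m _ ->] y /= /val_inj->; apply: phi_xi.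
(* One inequality is the down-set property of [H], the other its closure under lateral joins in the
   first coordinate. *)
apply/eqP; rewrite eq_le lexI; apply/andP; split.
  by apply/andP; split; apply/inH;
    apply: (down _ (val (x `|` y)%O) _ _ _ (lexx _));
    rewrite ?leUl ?leUr //; apply/inH.
by apply/inH; apply: HA; apply/inH; rewrite ?leIl ?leIr.
Qed.

Lemma interpolation_adjustment xi :
  (forall phi : nonzero A -> set B, (forall x, ideal (phi x)) ->
    {morph phi : x y / (x `|` y)%O >-> (x `&` y)%classic} ->
    choice_function phi xi ->
    exists eta : nonzero A -> B,
      [/\ step_function eta, (forall a, xi a <= eta a /\ phi a (eta a)) &
          {morph eta : x y / (x `|` y)%O >-> (x `&` y)%O}]) ->
  step_function xi -> eventually_constant (adjustment_seq xi).
Proof.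
move=> interp xi_step.
have seqS n := step_adjustment_seq n xi_step.
pose phi x := [set b | exists n, b <= adjustment_seq xi n x].
have [x|x y|x|eta [eta_step eta_phi etaM]] := interp phi.
- split=> [|b c bc [n cn]|b c [m bm] [n cn]].
  + by exists \bot, 0; exact: le0x.
  + by exists n; apply: le_trans cn.
  exists (maxn m n); rewrite leUx.
  by rewrite (le_trans bm) ?(le_trans cn) // adjustment_seq_le ?leq_maxl ?leq_maxr.
- apply/seteqP; split=> [b [n bn]|b [[m bm] [n bn]]].
    (* Stage 0 need not be antitone; every later stage is. *)
    have {}bn : b <= adjustment_seq xi n.+1 (x `|` y)%O.
      exact: le_trans bn (le_adjustment _ _).
    by split; exists n.+1; apply: le_trans bn _; apply: adjustment_anti;
      rewrite ?leUl ?leUr.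
  exists (maxn m n).+1; apply: le_trans (meet_le_adjustment _ _ _) => //.
  rewrite lexI (le_trans bm) ?(le_trans bn) //;
  by rewrite adjustment_seq_le ?leq_maxl ?leq_maxr.
- by exists 0; exact: lexx.
have [M etaM'] := step_function_dominated eta_step.
have /choice[N NP] x : exists n, eta x <= adjustment_seq xi n x := (eta_phi x).2.
(* By stage [K] the sequence has reached [eta m] for every [m] in [M]. Going strictly beyond [K]
   makes the stage an adjustment, hence antitone, so the bound passes from [m] to every [x] below
   it. *)
pose K := (\max_(m <- M) N m)%N.
have etaE n : (K < n)%N -> adjustment_seq xi n = eta.
  move=> Kn; apply/funext => x; apply/eqP; rewrite eq_le.
  rewrite adjustment_seq_le_morph //=; last by move=> y; case: (eta_phi y).
  have [/eqP->|/etaM'[m mM [xm <-]]] := boolP (eta x == \bot); first exact: le0x.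
  case: n Kn => // n Kn; apply: le_trans (adjustment_anti (seqS n) xm).
  apply: le_trans (NP m) _; apply: (@adjustment_seq_le _ _ _ _ xi _ n.+1) => //.
  by apply: leqW; move: Kn; rewrite ltnS; apply: leq_trans; apply: leq_bigmax_seq.
by exists K.+1 => n Kn; rewrite !etaE.
Qed.

Lemma adjustment_capped :
  (forall xi, step_function xi -> eventually_constant (adjustment_seq xi)) ->
  capped_tensor_product A B.
Proof.
move=> adj H [s HE].
have HH : bi_ideal H by rewrite HE; exact: bi_ideal_join_bi_ideal.
have sH : [set` s] `<=` H by move=> p ps; rewrite HE; exact: pure_tensor_join.
pose xi := tensor_section s.
have xi_step : step_function xi := step_tensor_section s.
have [N NP] := adj _ xi_step; pose eta := adjustment_seq xi N.
have eta_step : step_function eta := step_adjustment_seq N xi_step.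
have eta_fix : adjustment eta = eta by exact: NP N.+1 (leqnSn N).
have etaM := adjustment_fixed_morph eta_step eta_fix.
have Heta x : H (val x, eta x).
  rewrite /eta; elim: N {NP eta eta_step eta_fix etaM} x => [|n IHn] x.
    exact: section_in_bi_ideal.
  by apply: adjustment_in_bi_ideal => //; exact: step_adjustment_seq.
have [M eta_dom] := step_function_dominated eta_step.
(* The pair of zeros supplies [tensor_bot] even when [M] is empty. *)
exists ((\bot, \bot) |` [fset (val m, eta m) | m in M])%fset.
apply/seteqP; split=> [[a b] Hab|p [_ /fset1UP[->|/imfsetP[m _ ->]]]].
(* The graph of [eta] is a bi-ideal containing the generators of [H], because [eta] dominates
   [xi]. *)
- have Gab : hom_graph (fun x => [set b | b <= eta x]) (a, b).
    move: Hab; rewrite HE; apply: bi_ideal_join_sub.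
      exact: principal_graph_bi_ideal.
    move=> [c e] ce x /= xc; apply: (@le_trans _ _ (xi x)).
      by apply: joins_sup_seq ce _; rewrite [val x]xc.
    exact: (@adjustment_seq_le _ _ _ _ xi 0 N).
  have bot_in : tensor_bot (a, b) -> (\bigcup_(p in [set`
      ((\bot, \bot) |` [fset (val m, eta m) | m in M])%fset]) pure_tensor p) (a, b).
    by move=> ab0; exists (\bot, \bot); [rewrite /= fset1U1 | left].
  have [a0|a0] := eqVneq a \bot; first by apply: bot_in; left.
  have [b0|b0] := eqVneq b \bot; first by apply: bot_in; right.
  have /= b_eta := Gab (Sub a a0) erefl.
  have [|m mM [am etam]] := eta_dom (Sub a a0).
    by apply: contraNneq b0 => eta0; rewrite -lex0 -eta0.
  exists (val m, eta m); first by rewrite /= fset1Ur // in_imfset.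
  by right; split; rewrite //= etam.
- by apply: pure_tensor_sub => //; have [H0 _ _ _] := HH; apply: H0; left.
- by apply: pure_tensor_sub.
Qed.

End BiIdeals.

Theorem theorem4 (dA dB : Order.disp_t)
    (A : bLatticeType dA) (B : bLatticeType dB) :
  [<-> capped_tensor_product A B;
       forall (phi : nonzero A -> set B) (xi : nonzero A -> B),
         (forall x, ideal (phi x)) ->
         {morph phi : x y / (x `|` y)%O >-> (x `&` y)%classic} ->
         step_function xi ->
         choice_function phi xi ->
         exists eta : nonzero A -> B,
           [/\ step_function eta,
               (forall a, xi a <= eta a /\ phi a (eta a)) &
               {morph eta : x y / (x `|` y)%O >-> (x `&` y)%O}];
       forall xi : nonzero A -> B,
         step_function xi -> eventually_constant (adjustment_seq xi)].
Proof.
split=> [capped phi xi phi_id phiM xi_step|]; first exact: capped_interpolation.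
split=> [interp xi xi_step|]; last exact: adjustment_capped.
by apply: interpolation_adjustment => // phi phi_id phiM; exact: interp.
Qed.
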